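(* Let $m,n$ be positive integers and let $\mathcal{P}(m,n)\subseteq\mathbb{R}^m$ be the convex hull of all words of length $m$ with entries in $\{0,1,\ldots,n\}$ whose nonzero entries are pairwise distinct. Then the number of facets of $\mathcal{P}(m,n)$ equals \[ m+2^m-1-\sum_{r=1}^{m-n}\binom{m}{m-r}, \] where the sum is empty if $m\le n$.
   Context: Words of length $m$ are regarded as vectors in $\mathbb{R}^m$. *)

(* Defs.v *)
From mathcomp Require Import all_boot all_order all_algebra.
From mathcomp Require Import boolp classical_sets functions cardinality reals.
From mathcomp Require Import convex.

Set Implicit Arguments.
Unset Strict Implicit.
Unset Printing Implicit Defensive.

Import Order.TTheory GRing.Theory Num.Theory.

Local Open Scope classical_set_scope.
Local Open Scope ring_scope.

Definition convex_hull (R : realType) (m : nat) (A : set 'rV[R]_m) :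
    set 'rV[R]_m :=
  smallest (@convex_set R 'rV[R]_m) A.

Definition affine_set (R : realType) (m : nat) (A : set 'rV[R]_m) : Prop :=
  forall (x y : 'rV[R]_m) (t : R), A x -> A y -> A ((1 - t) *: x + t *: y).

Definition affine_hull (R : realType) (m : nat) (A : set 'rV[R]_m) :
    set 'rV[R]_m :=
  smallest (@affine_set R m) A.

(* The dimension of a set is that of its affine hull, and -1 if it is empty. *)
Definition has_dim (R : realType) (m : nat) (A : set 'rV[R]_m) (d : int) :
    Prop :=
  (A = set0 /\ d = -1) \/
  (exists (x : 'rV[R]_m) (V : {vspace 'rV[R]_m}),
     affine_hull A = [set x + v | v in [set` V]] /\ d = (\dim V)%:Z).

Definition dotprod (R : realType) (m : nat) (a x : 'rV[R]_m) : R :=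
  \sum_(i < m) a ord0 i * x ord0 i.

(* Improper faces are included: a = 0 gives P itself (b = 0) and set0 (b = 1). *)
Definition is_face (R : realType) (m : nat) (P F : set 'rV[R]_m) : Prop :=
  exists (a : 'rV[R]_m) (b : R),
    (forall x, P x -> dotprod a x <= b) /\
    F = [set x | P x /\ dotprod a x = b].

Definition facets (R : realType) (m : nat) (P : set 'rV[R]_m) :
    set (set 'rV[R]_m) :=
  [set F | is_face P F /\ exists d : int, has_dim P d /\ has_dim F (d - 1)].

Definition partial_perm_word (m n : nat) (w : m.-tuple 'I_n.+1) : bool :=
  uniq [seq c <- w | c != ord0].

Definition word_vec (R : realType) (m n : nat) (w : m.-tuple 'I_n.+1) :
    'rV[R]_m :=
  \row_(i < m) (nat_of_ord (tnth w i))%:R.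

Definition partial_perm_polytope (R : realType) (m n : nat) : set 'rV[R]_m :=
  convex_hull
    [set word_vec R w | w in [set w : m.-tuple 'I_n.+1 | partial_perm_word w]].

Arguments partial_perm_polytope : clear implicits.

(* Main.v *)
(* The facets are cut out by the inequalities x_i >= 0 and, for every nonempty
   S with |S| < n or S = {1, ..., m}, by sum_S x <= n + (n-1) + ... (|S| terms,
   cut off at 0).  The omitted sets S are those with n <= |S| < m, whence the
   subtracted sum of binomials.

   Let a x <= b define a facet.  If a has a negative entry a_i, all words
   maximizing a vanish at i.  Otherwise every maximizing word puts the largest
   possible letters on the set where a is maximal.  In both cases the words on
   the facet lie on one of the hyperplanes above; a facet spans its hyperplane,
   so the two hyperplanes agree.  Conversely, each listed face is a facet,
   since only multiples of its normal vector are constant on its words. *)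

Require Import Defs.
From HB Require Import structures.
From mathcomp Require Import all_boot all_order all_algebra.
From mathcomp Require Import boolp classical_sets functions cardinality reals.
From mathcomp Require Import perm unstable interval_inference convex zify ring lra.

Import Order.TTheory GRing.Theory Num.Theory.

Local Open Scope ring_scope.

(** * Affine hulls, dimension and orthogonal complements *)

Section Hulls.
Local Open Scope classical_set_scope.
Set Implicit Arguments.
Unset Strict Implicit.
Context {R : realType} {m : nat}.
Implicit Types (a c x y : 'rV[R]_m) (A B : set 'rV[R]_m) (V W : {vspace 'rV[R]_m}).

Lemma dotprodC a x : dotprod a x = dotprod x a.
Proof. by apply: eq_bigr => i _; rewrite mulrC. Qed.

Lemma dotprodDr a x y : dotprod a (x + y) = dotprod a x + dotprod a y.
Proof. by rewrite -big_split; apply: eq_bigr => i _; rewrite mxE mulrDr. Qed.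

Lemma dotprodZr a (t : R) x : dotprod a (t *: x) = t * dotprod a x.
Proof. by rewrite mulr_sumr; apply: eq_bigr => i _; rewrite mxE mulrCA. Qed.

Lemma dotprodDl a c x : dotprod (a + c) x = dotprod a x + dotprod c x.
Proof. by rewrite dotprodC dotprodDr !(dotprodC x). Qed.

Lemma dotprodZl (t : R) a x : dotprod (t *: a) x = t * dotprod a x.
Proof. by rewrite dotprodC dotprodZr dotprodC. Qed.

Lemma dotprodNr a x : dotprod a (- x) = - dotprod a x.
Proof. by rewrite -scaleN1r dotprodZr mulN1r. Qed.

Lemma dotprodNl a x : dotprod (- a) x = - dotprod a x.
Proof. by rewrite dotprodC dotprodNr dotprodC. Qed.

Lemma dotprod0l x : dotprod 0 x = 0.
Proof. by rewrite -(scale0r 0) dotprodZl mul0r. Qed.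

Lemma dotprod_delta i x : dotprod (delta_mx 0 i) x = x ord0 i.
Proof.
rewrite /dotprod (bigD1 i) //= big1 => [|j ji]; rewrite !mxE !eqxx.
  by rewrite mul1r addr0.
by rewrite (negbTE ji) mul0r.
Qed.

Lemma dotprod_eq0 x : dotprod x x = 0 -> x = 0.
Proof.
move=> /eqP; rewrite psumr_eq0 => [/allP x0|i _]; last by rewrite -expr2 sqr_ge0.
apply/rowP => i; rewrite mxE; apply/eqP.
by have := x0 i (mem_index_enum i); rewrite mulf_eq0 orbb.
Qed.

Lemma sub_convex_hull A : A `<=` convex_hull A.
Proof. exact: sub_gen_smallest. Qed.

Lemma convex_hull_halfspace A a b :
  (forall x, A x -> dotprod a x <= b) ->
  forall x, convex_hull A x -> dotprod a x <= b.
Proof.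
move=> Ab; apply: smallest_sub => //= x y t; rewrite !inE /= => xb yb.
rewrite dotprodDr !dotprodZr.
have [] : 0 <= t%:inum /\ t%:inum <= 1 by split.
move: (t%:inum) => s s0 s1; rewrite /onem.
have := ler_wpM2l s0 xb; have : 0 <= 1 - s by rewrite subr_ge0.
by move=> /ler_wpM2l /(_ _ _ yb); lra.
Qed.

Lemma sub_affine_hull A : A `<=` affine_hull A.
Proof. exact: sub_gen_smallest. Qed.

Lemma affine_set_affine_hull A : affine_set (affine_hull A).
Proof. by move=> x y t Ax Ay B [Baff AB]; apply: (Baff); [exact: Ax|exact: Ay]. Qed.

Lemma affine_hull_hyperplane A a b :
  (forall x, A x -> dotprod a x = b) ->
  forall x, affine_hull A x -> dotprod a x = b.
Proof.
move=> Ab; apply: smallest_sub => //= x y t xb yb.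
by rewrite dotprodDr !dotprodZr xb yb; ring.
Qed.

(** [V] is taken of maximal dimension among the subspaces whose translate by [x] stays in [A]; a
    point of [A] outside this translate would allow a larger subspace. *)
Lemma affine_set_translate A x :
  affine_set A -> A x ->
  exists V, A = [set x + v | v in [set` V]].
Proof.
move=> Aaff Ax.
have AZ t v : A (x + v) -> A (x + t *: v).
  move=> /(Aaff _ _ t Ax); congr A.
  by rewrite scalerDr addrA -scalerDl subrK scale1r.
(* The point [x + (u + v)] lies twice as far from [x] as the midpoint of [x + u] and [x + v]. *)
have AD u v : A (x + u) -> A (x + v) -> A (x + (u + v)).
  move=> Au /(Aaff _ _ 2^-1 Au) Auv.
  have -> : u + v = 2 *: (2^-1 *: (u + v)) by rewrite scalerA divff ?scale1r.
  apply: AZ; move: Auv; congr A; apply/rowP => i; rewrite !mxE.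
  by field.
pose P d := `[< exists V, \dim V = d /\ forall v, v \in V -> A (x + v) >].
have P0 : exists d, P d.
  exists 0%N; apply/asboolP; exists 0%VS; rewrite dimv0; split=> // v.
  by rewrite memv0 => /eqP->; rewrite addr0.
have Pm d : P d -> (d <= dim 'rV[R]_m)%N.
  by move=> /asboolP[V [<- _]]; rewrite -dimvf dimvS ?subvf.
case: (ex_maxnP P0 Pm) => d /asboolP[V [dV AV]] dmax; exists V.
apply/seteqP; split=> [y Ay|_ [v /= vV <-]]; last exact: AV.
exists (y - x) => /=; last by rewrite addrC subrK.
apply: contrapT => /negP yV.
have : P (\dim (V + <[y - x]>)%VS).
  apply/asboolP; exists (V + <[y - x]>)%VS; split=> //.
  move=> _ /memv_addP[u uV [_ /vlineP[t ->] ->]]; apply: AD; first exact: AV.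
  by apply: AZ; rewrite addrC subrK.
move=> /dmax; rewrite -dV; apply/negP; rewrite -ltnNge ltnNge.
apply: contra yV => le; suff -> : V = (V + <[y - x]>)%VS.
  by rewrite (subvP (addvSr _ _)) ?memv_line.
by apply/eqP; rewrite eqEdim addvSl.
Qed.

(** [U] is the kernel of the pairing with a basis of [V]. Rank-nullity bounds its dimension from
    below; the upper bound holds because [U] meets [V] only in 0, the sole vector orthogonal to
    itself. *)
Lemma orth_exists V :
  exists U : {vspace 'rV[R]_m}, (\dim U + \dim V = m)%N /\
    forall a, a \in U <-> forall v, v \in V -> dotprod a v = 0.
Proof.
pose f a : 'rV[R]_(\dim V) := \row_j dotprod a (vbasis V)`_j.
have flin : linear f.
  move=> t a b; apply/rowP => j.
  by rewrite !mxE !(dotprodC _ _`_j) dotprodDr dotprodZr.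
pose fL := GRing.isLinear.Build _ _ _ _ f flin.
pose F : {linear _ -> _} := HB.pack f fL.
exists (lker (linfun F)).
have lkerP a : a \in lker (linfun F) <-> forall v, v \in V -> dotprod a v = 0.
  rewrite memv_ker lfunE /=; split=> [/eqP fa0 v vV|av].
    rewrite (coord_vbasis vV) /dotprod.
    under eq_bigr do rewrite summxE mulr_sumr.
    rewrite exchange_big big1 // => j _.
    have /rowP/(_ j) := fa0; rewrite !mxE => aj.
    under eq_bigr do rewrite mxE mulrCA.
    by rewrite -mulr_sumr -/(dotprod _ _) aj mulr0.
  by apply/eqP/rowP => j; rewrite !mxE av // vbasis_mem ?mem_nth ?size_tuple.
split=> //; have dimfull : (\dim {: 'rV[R]_m} = m)%N.
  by rewrite dimvf dim_matrix mul1r.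
apply/eqP; rewrite eqn_leq; apply/andP; split.
  rewrite -dimv_disjoint_sum; last first.
    apply/eqP; rewrite -subv0; apply/subvP => v.
    rewrite memv_cap memv0 => /andP[/lkerP vU vV].
    by apply/eqP/dotprod_eq0/vU.
  by rewrite -[leqRHS]dimfull dimvS ?subvf.
rewrite -[leqLHS]dimfull -(limg_ker_dim (linfun F)) capfv leq_add2l.
apply: leq_trans (dimvS (subvf _)) _.
by rewrite dimvf dim_matrix mul1r.
Qed.

Lemma translate_vspace_inj x y V W :
  [set x + v | v in [set` V]] = [set y + v | v in [set` W]] -> V = W.
Proof.
have sub u v (U U' : {vspace 'rV[R]_m}) :
    [set u + w | w in [set` U]] = [set v + w | w in [set` U']] -> (U <= U')%VS.
  move=> e; apply/subvP => w wU.
  have [z zU' zu] : [set v + w | w in [set` U']] u.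
    by rewrite -e; exists 0; rewrite /= ?mem0v ?addr0.
  have [z' z'U' z'u] : [set v + w | w in [set` U']] (u + w) by rewrite -e; exists w.
  have -> : w = z' - z by apply: (addrI u); rewrite -z'u -zu -addrA (addrC z) subrK.
  exact: memvB.
by move=> e; apply/eqP; rewrite eqEsubv (sub x y) ?(sub y x).
Qed.

(** As [has_dim] is a relation, this is what allows two dimensions of one set to be compared. The
    two cases exclude each other because the affine hull of the empty set is empty. *)
Lemma has_dim_uniq A (d d' : int) : has_dim A d -> has_dim A d' -> d = d'.
Proof.
have aff0 x V : affine_hull (set0 : set 'rV[R]_m) <> [set x + v | v in [set` V]].
  move=> /seteqP[_ /(_ x)]; suff -> : affine_hull (set0 : set 'rV[R]_m) = set0.
    by apply; exists 0; rewrite /= ?mem0v ?addr0.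
  exact: smallest_id.
move=> [[A0 ->]|[x [V [AV ->]]]] [[A0' ->]|[y [W [AW ->]]]] //.
- by case: (aff0 y W); rewrite -AW A0.
- by case: (aff0 x V); rewrite -AV A0'.
- by rewrite (@translate_vspace_inj x y V W) // -AV -AW.
Qed.

(** The functionals constant on [A] are those orthogonal to the direction space of its affine hull,
    so they form a space whose dimension is the codimension of [A]. *)
Lemma has_dim_normals A x : A x ->
  exists U : {vspace 'rV[R]_m},
    (forall a, a \in U <-> forall y, A y -> dotprod a y = dotprod a x) /\
    has_dim A (m%:Z - (\dim U)%:Z).
Proof.
move=> Ax; have Ahx := sub_affine_hull Ax.
have [V AV] := affine_set_translate (@affine_set_affine_hull A) Ahx.
have [U [dimU UP]] := orth_exists V; exists U; split=> [a|]; last first.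
  by right; exists x, V; split=> //; rewrite -{1}dimU PoszD addrAC subrr add0r.
rewrite UP; split=> [av y /sub_affine_hull|ay v vV].
  by rewrite AV => -[v /av av0 <-]; rewrite dotprodDr av0 addr0.
apply: (addrI (dotprod a x)); rewrite addr0 -dotprodDr.
by apply: (affine_hull_hyperplane ay); rewrite AV; exists v.
Qed.

(** The space of functionals constant on [A] contains the line through [a], and it is that line
    exactly when [A] has codimension 1. *)
Lemma has_dim_hyperplane A a x :
  A x -> a != 0 -> (forall y, A y -> dotprod a y = dotprod a x) ->
  has_dim A (m%:Z - 1) <->
  forall c, (forall y, A y -> dotprod c y = dotprod c x) ->
    exists t, c = t *: a.
Proof.
move=> Ax a0 aA; have [U [UP dU]] := has_dim_normals Ax.
have aU : (<[a]> <= U)%VS by rewrite -memvE; apply/UP.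
split=> [/(has_dim_uniq dU) dimU c /UP cU|cP].
  apply/vlineP; suff -> : <[a]>%VS = U by [].
  apply/eqP; rewrite eqEdim aU dim_vline a0 /=.
  by case: (oppr_inj (addrI _ dimU)) => ->.
suff <- : (\dim U)%:Z = 1 by [].
suff -> : U = <[a]>%VS by rewrite dim_vline a0.
apply/eqP; rewrite eqEsubv aU andbT; apply/subvP => c /UP/cP[t ->].
by rewrite memvZ ?memv_line.
Qed.

End Hulls.

(** * Words with distinct nonzero letters and their largest letter sums *)

Section Words.
Set Implicit Arguments.
Unset Strict Implicit.
Context {m n : nat}.
Implicit Types (w : m.-tuple 'I_n.+1) (S T : {set 'I_m}) (i j : 'I_m).

Definition supp w : {set 'I_m} := [set i | tnth w i != ord0].

Lemma partial_perm_wordP w :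
  reflect {in supp w &, injective (tnth w)} (partial_perm_word w).
Proof.
have -> : partial_perm_word w = dinjectiveb (tnth w) (supp w).
  rewrite /partial_perm_word /dinjectiveb -{1}(map_tnth_enum w) filter_map.
  congr uniq; congr map; rewrite enumT; apply: eq_filter => i.
  by rewrite /= inE.
exact: dinjectiveP.
Qed.

Definition set_letter w i (v : 'I_n.+1) : m.-tuple 'I_n.+1 :=
  [tuple if k == i then v else tnth w k | k < m].

Definition swap_letters w i j : m.-tuple 'I_n.+1 :=
  [tuple tnth w (tperm i j k) | k < m].

Definition clear_outside w S : m.-tuple 'I_n.+1 :=
  [tuple if k \in S then tnth w k else ord0 | k < m].

Lemma word_set_letter w i v :
  partial_perm_word w ->
  (v != ord0 -> forall k, k != i -> tnth w k != v) ->
  partial_perm_word (set_letter w i v).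
Proof.
move=> /partial_perm_wordP winj wv; apply/partial_perm_wordP => k l.
rewrite !inE !tnth_mktuple.
case: (eqVneq k i) => [->|ki]; case: (eqVneq l i) => [->|li] //.
- by move=> v0 _ /esym/eqP; rewrite (negbTE (wv v0 l li)).
- by move=> _ v0 /eqP; rewrite (negbTE (wv v0 k ki)).
- by move=> k0 l0; apply: winj; rewrite inE.
Qed.

Lemma word_swap_letters w i j :
  partial_perm_word w -> partial_perm_word (swap_letters w i j).
Proof.
move=> /partial_perm_wordP winj; apply/partial_perm_wordP => k l.
rewrite !inE !tnth_mktuple => k0 l0 /winj; rewrite !inE => /(_ k0 l0).
exact: perm_inj.
Qed.

Lemma word_clear_outside w S :
  partial_perm_word w -> partial_perm_word (clear_outside w S).
Proof.
move=> /partial_perm_wordP winj; apply/partial_perm_wordP => k l.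
rewrite !inE !tnth_mktuple.
by do 2![case: ifP => _; rewrite ?eqxx //]; move=> ? ?; apply: winj; rewrite inE.
Qed.

Definition subset_sum w S : nat := \sum_(i in S) tnth w i.

Definition above w S (h : nat) : {set 'I_m} := [set i in S | (h < tnth w i)%N].

(* [max_sum k] is n + (n - 1) + ... + (n - k + 1), cut off at 0, counted by
   levels: the h-th term bounds the number of letters exceeding h. *)
Definition max_sum (k : nat) : nat := (\sum_(h < n) minn k (n - h))%N.

(** A letter is the number of levels [h] strictly below it; then the two summations are
    exchanged. *)
Lemma subset_sum_above w S : subset_sum w S = (\sum_(h < n) #|above w S h|)%N.
Proof.
rewrite /subset_sum (eq_bigr (fun i => \sum_(h < n) (h < tnth w i)%N)%N); last first.
  move=> i _; rewrite -(big_mkord xpredT (fun h => nat_of_bool (h < tnth w i)%N)).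
  rewrite (@big_cat_nat _ _ _ (tnth w i)) //=; last by rewrite -ltnS.
  rewrite (eq_big_nat _ _ (F2 := fun=> 1%N)) => [|h]; last by move=> /andP[_ ->].
  rewrite sum_nat_const_nat subn0 muln1 big_nat big1 ?addn0 // => h /andP[wi _].
  by rewrite ltnNge wi.
rewrite exchange_big; apply: eq_bigr => h _ /=.
rewrite -sum1_card big_mkcond [RHS]big_mkcond; apply: eq_bigr => i _.
by rewrite inE; case: (i \in S) => //=; case: ltnP.
Qed.

Lemma letters_above_uniq w S h :
  partial_perm_word w -> uniq [seq (tnth w i : nat) | i <- enum (above w S h)].
Proof.
move=> /partial_perm_wordP winj; rewrite map_inj_in_uniq ?enum_uniq // => i j.
rewrite !mem_enum !inE => /andP[_ wi] /andP[_ wj] /val_inj; apply: winj.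
  by rewrite inE -val_eqE /= -lt0n (leq_ltn_trans _ wi).
by rewrite inE -val_eqE /= -lt0n (leq_ltn_trans _ wj).
Qed.

(** The letters above [h] are nonzero, hence distinct, and lie in {h+1, ..., n}; this gives the
    bound [n - h]. *)
Lemma card_above_le w S h :
  partial_perm_word w -> (#|above w S h| <= minn #|S| (n - h))%N.
Proof.
move=> ww; rewrite leq_min subset_leq_card /=; last first.
  by apply/fintype.subsetP => i; rewrite inE => /andP[].
rewrite cardE -(size_map (fun i => tnth w i : nat)) -(size_iota h.+1 (n - h)).
apply: uniq_leq_size (letters_above_uniq _ _ ww) _ => _ /mapP[i + ->].
rewrite mem_enum inE => /andP[_ wi]; rewrite mem_iota wi /= addSn ltnS.
by have := ltn_ord (tnth w i); lia.
Qed.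

Lemma subset_sum_le w S :
  partial_perm_word w -> (subset_sum w S <= max_sum #|S|)%N.
Proof.
by move=> ww; rewrite subset_sum_above leq_sum // => h _; exact: card_above_le.
Qed.

(** Each level is bounded separately, so equality of the sums forces equality at every level. *)
Lemma subset_sum_eq w S : partial_perm_word w ->
  subset_sum w S = max_sum #|S| <->
  forall h, (h < n)%N -> #|above w S h| = minn #|S| (n - h).
Proof.
move=> ww; rewrite subset_sum_above; split=> [/eqP|aboveE].
  rewrite (leqif_sum (C := fun h : 'I_n => #|above w S h| == minn #|S| (n - h))).
    by move=> /forallP e h hn; exact/eqP/(e (Ordinal hn)).
  by move=> h _; split=> //; exact: card_above_le.
by apply: eq_bigr => h _; exact: aboveE.
Qed.

(** Once [k] reaches [n], every level is capped by [n - h] alone. *)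
Lemma max_sum_large k : (n <= k)%N -> max_sum k = max_sum n.
Proof.
by move=> nk; apply: eq_bigr => h _; rewrite !(minn_idPr _) ?leq_subr //; lia.
Qed.

Lemma max_sum_gt0 k : (0 < n)%N -> (0 < k)%N -> (0 < max_sum k)%N.
Proof.
rewrite /max_sum; case: n => // n' _ k0.
by rewrite big_ord_recl addn_gt0 leq_min k0.
Qed.

(** Some level [h] has too few letters above it: fewer than [#|S|], so a position of [S] holds a
    letter at most [h], and fewer than [n - h], so a letter above [h] is missing from [S]. *)
Lemma letter_to_raise w S : partial_perm_word w ->
  subset_sum w S <> max_sum #|S| ->
  exists (v : 'I_n.+1) i, [/\ i \in S, (tnth w i < v)%N
    & forall j, j \in S -> tnth w j != v].
Proof.
move=> ww neq.
have [h hn lt] : exists2 h, (h < n)%N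
    & (#|above w S h| < minn #|S| (n - h))%N.
  apply: contrapT => noh; apply/neq/subset_sum_eq => // h hn.
  apply/eqP; rewrite eqn_leq card_above_le //= leqNgt; apply/negP => lt.
  by apply: noh; exists h.
move: lt; rewrite leq_min => /andP[ltS ltn].
have [i iS wi] : exists2 i, i \in S & (tnth w i <= h)%N.
  apply: contrapT => noi; move: ltS; rewrite ltnNge => /negP; apply.
  apply/subset_leq_card/fintype.subsetP => i iS; rewrite inE iS /= ltnNge.
  by apply/negP => wi; apply: noi; exists i.
have [v hv vS] : exists2 v, v \in iota h.+1 (n - h)
    & v \notin [seq (tnth w i : nat) | i <- enum (above w S h)].
  apply: contrapT => nov; move: ltn; rewrite ltnNge => /negP; apply.
  rewrite cardE -(size_map (fun i => tnth w i : nat)) -{1}(size_iota h.+1 (n - h)).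
  apply: uniq_leq_size => [|v hv]; first exact: iota_uniq.
  by apply: contrapT => /negP vS; apply: nov; exists v.
move: hv; rewrite mem_iota => /andP[hv vn].
have vn1 : (v < n.+1)%N by lia.
exists (Ordinal vn1), i; split=> [//||j jS]; first exact: leq_ltn_trans wi hv.
apply: contra vS => /eqP wj; apply/mapP; exists j; rewrite ?wj //.
by rewrite mem_enum inE jS wj.
Qed.

End Words.

(** * Words maximizing a linear functional *)

Section WordVectors.
Set Implicit Arguments.
Unset Strict Implicit.
Context {R : realType} {m n : nat}.
Implicit Types (w : m.-tuple 'I_n.+1) (S T : {set 'I_m}) (i j : 'I_m).
Implicit Types (a : 'rV[R]_m).

Definition indicator S : 'rV[R]_m := \row_i (i \in S)%:R.

Lemma dotprod_indicator w S :
  dotprod (indicator S) (word_vec R w) = (subset_sum w S)%:R.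
Proof.
rewrite /dotprod /subset_sum natr_sum [RHS]big_mkcond; apply: eq_bigr => i _.
by rewrite !mxE; case: (i \in S); rewrite ?mul1r ?mul0r.
Qed.

Lemma dotprod_set_letter a w i v :
  dotprod a (word_vec R (set_letter w i v)) =
  dotprod a (word_vec R w) + a ord0 i
    * ((nat_of_ord v)%:R - (nat_of_ord (tnth w i))%:R).
Proof.
rewrite /dotprod (bigD1 i) //= [in RHS](bigD1 i) //= !mxE tnth_mktuple eqxx.
rewrite [X in _ + X](eq_bigr (fun k => a ord0 k * word_vec R w ord0 k)); first ring.
by move=> k ki; rewrite !mxE tnth_mktuple (negbTE ki).
Qed.

Lemma dotprod_swap_letters a w i j :
  dotprod a (word_vec R (swap_letters w i j)) =
  dotprod a (word_vec R w) + (a ord0 i - a ord0 j)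
    * ((nat_of_ord (tnth w j))%:R - (nat_of_ord (tnth w i))%:R).
Proof.
have [->|ij] := eqVneq i j.
  rewrite !subrr mul0r addr0; congr (dotprod a _); apply/rowP => k.
  by rewrite !mxE tnth_mktuple tperm1 perm1.
have ji : j != i by rewrite eq_sym.
rewrite /dotprod (bigD1 i) //= (bigD1 j) //= [in RHS](bigD1 i) //=.
rewrite [in RHS](bigD1 j) //= !mxE !tnth_mktuple tpermL tpermR.
rewrite [X in _ + (_ + X) = _](eq_bigr (fun k => a ord0 k * word_vec R w ord0 k)).
  ring.
by move=> k /andP[ki kj]; rewrite !mxE tnth_mktuple tpermD // eq_sym.
Qed.

Definition optimal a w := partial_perm_word w /\
  forall w', partial_perm_word w' ->
    dotprod a (word_vec R w') <= dotprod a (word_vec R w).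

Lemma optimal_exists a : exists w, optimal a w.
Proof.
pose w0 : m.-tuple 'I_n.+1 := [tuple ord0 | _ < m].
have ww0 : partial_perm_word w0.
  by apply/partial_perm_wordP => i j; rewrite !inE !tnth_mktuple.
case: (arg_maxP (fun w => dotprod a (word_vec R w)) ww0) => w ww wmax.
by exists w.
Qed.

Lemma optimal_negative a w i : optimal a w -> a ord0 i < 0 -> tnth w i = ord0.
Proof.
move=> [ww wmax] ai; apply/val_inj/eqP; rewrite /= -leqn0 leqNgt; apply/negP => wi.
have /wmax : partial_perm_word (set_letter w i ord0).
  by apply: word_set_letter.
apply/negP; rewrite -ltNge dotprod_set_letter ltrDl.
by rewrite nmulr_rgt0 // subr_lt0 ltr_nat.
Qed.

(** Otherwise the word could be improved: the larger letter [v] missing from [S] is either swapped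
    in from a position outside [S], where the coefficient is smaller, or is new to the word and can
    be written directly. *)
Lemma optimal_argmax a w S (M : R) : 0 < M ->
  (forall i, i \in S -> a ord0 i = M) -> (forall i, i \notin S -> a ord0 i < M) ->
  optimal a w -> subset_sum w S = max_sum (n := n) #|S|.
Proof.
move=> M0 aS aNS [ww wmax]; apply: contrapT => /(letter_to_raise ww)[v [i [iS wi wv]]].
have [/existsP[j /eqP wj]|/existsPn nov] := boolP [exists j, tnth w j == v].
  have jS : j \notin S by apply/negP => /wv; rewrite wj eqxx.
  have := wmax _ (word_swap_letters i j ww); apply/negP.
  rewrite -ltNge dotprod_swap_letters ltrDl wj aS //.
  by rewrite mulr_gt0 // subr_gt0 ?ltr_nat ?aNS.
have /wmax : partial_perm_word (set_letter w i v).
  by apply: word_set_letter => // _ k _; exact: nov.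
apply/negP; rewrite -ltNge dotprod_set_letter ltrDl aS //.
by rewrite mulr_gt0 // subr_gt0 ltr_nat.
Qed.

Definition facet_subset S :=
  (S != finset.set0) && ((#|S| < n)%N || (S == finset.setT)).

(** The witness is the set where [a] is maximal, or all positions when that set has [n] or more
    elements. *)
Lemma optimal_subset_sum a i : 0 < a ord0 i ->
  exists2 S, facet_subset S &
    forall w, optimal a w -> subset_sum w S = max_sum (n := n) #|S|.
Proof.
move=> ai; case: (@Order.TotalTheory.arg_maxP _ _ _ i xpredT (a ord0)) => // k _ kmax.
pose S := [set j | a ord0 j == a ord0 k].
have a0 : 0 < a ord0 k by apply: lt_le_trans ai (kmax i _).
have sumS w : optimal a w -> subset_sum w S = max_sum (n := n) #|S|.
  apply: optimal_argmax a0 _ _ => j; rewrite inE; first by move/eqP.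
  by move=> jk; rewrite lt_neqAle jk; exact: kmax.
have kS : k \in S by rewrite inE.
have S0 : S != finset.set0 by apply/set0Pn; exists k.
have [Sn|nS] := ltnP #|S| n; first by exists S; rewrite // /facet_subset S0 Sn.
(* With at least [n] positions, the letters on [S] already reach the overall bound [max_sum n],
   hence so does the sum over all positions. *)
exists finset.setT => [|w wopt].
  by rewrite /facet_subset eqxx orbT andbT; apply/set0Pn; exists k; rewrite inE.
have ww := wopt.1; apply/eqP; rewrite eqn_leq subset_sum_le //=.
have nT : (n <= #|[set: 'I_m]|)%N by rewrite cardsT (leq_trans nS) ?max_card.
rewrite (max_sum_large nT) -(max_sum_large nS) -(sumS w wopt).
rewrite /subset_sum [leqRHS](bigID (mem S)) /=.
by under [X in (_ <= X + _)%N]eq_bigl do rewrite inE; rewrite leq_addr.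
Qed.

End WordVectors.

Arguments facet_subset {m} n S.

(** * Tight words and the functionals constant on them *)

Section Facets.
Set Implicit Arguments.
Unset Strict Implicit.
Context {R : realType} {m n : nat}.
Context (m_gt0 : (0 < m)%N) (n_gt0 : (0 < n)%N).
Implicit Types (w : m.-tuple 'I_n.+1) (S T : {set 'I_m}) (i j : 'I_m).
Implicit Types (a c x : 'rV[R]_m) (k : 'I_m + {set 'I_m}).

Local Notation P := (partial_perm_polytope R m n).
Local Notation wvec := (@word_vec R m n).

(** Here [inl i] stands for the inequality x_i >= 0, and [inr A] for the one bounding the sum over
    [A]. *)
Definition facet_index : pred ('I_m + {set 'I_m}) :=
  fun k => if k is inr A then facet_subset n A else true.

Definition normal k : 'rV[R]_m :=
  match k with inl i => - delta_mx 0 i | inr A => indicator A end.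

Definition bound k : R :=
  match k with inl _ => 0 | inr A => (max_sum (n := n) #|A|)%:R end.

Definition tight k w :=
  partial_perm_word w /\ dotprod (normal k) (wvec w) = bound k.

Lemma dotprod_normall i w :
  dotprod (normal (inl i)) (wvec w) = - (nat_of_ord (tnth w i))%:R.
Proof. by rewrite dotprodNl dotprod_delta mxE. Qed.

Lemma tightl i w : partial_perm_word w -> tnth w i = ord0 -> tight (inl i) w.
Proof. by move=> ww wi; split=> //; rewrite dotprod_normall wi oppr0. Qed.

Lemma tightrP S w :
  tight (inr S) w <-> partial_perm_word w /\ subset_sum w S = max_sum (n := n) #|S|.
Proof.
split=> -[ww e]; split=> //; last by rewrite dotprod_indicator e.
by apply/eqP; rewrite -(eqr_nat R) -dotprod_indicator; apply/eqP.
Qed.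

Lemma normal_le k w : partial_perm_word w -> dotprod (normal k) (wvec w) <= bound k.
Proof.
case: k => [i|S] ww; first by rewrite dotprod_normall oppr_le0.
by rewrite dotprod_indicator ler_nat subset_sum_le.
Qed.

Lemma normal_neq0 k : facet_index k -> normal k != 0.
Proof.
case: k => [i _|S /andP[/set0Pn[i iS] _]]; apply/eqP => /rowP/(_ i)/eqP.
  by rewrite !mxE !eqxx oppr_eq0 oner_eq0.
by rewrite !mxE iS oner_eq0.
Qed.

Definition zero_word : m.-tuple 'I_n.+1 := [tuple ord0 | _ < m].

Lemma word_zero_word : partial_perm_word zero_word.
Proof. by apply/partial_perm_wordP => i j; rewrite !inE !tnth_mktuple. Qed.

Lemma dotprod_zero_word a : dotprod a (wvec zero_word) = 0.
Proof. by rewrite /dotprod big1 // => i _; rewrite mxE tnth_mktuple mulr0. Qed.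

Definition one_letter : 'I_n.+1 := Ordinal (n_gt0 : (1 < n.+1)%N).

Lemma word_unit i : partial_perm_word (set_letter zero_word i one_letter).
Proof.
by apply: word_set_letter word_zero_word _ => _ k _; rewrite tnth_mktuple.
Qed.

Lemma dotprod_unit a i : dotprod a (wvec (set_letter zero_word i one_letter)) = a ord0 i.
Proof.
by rewrite dotprod_set_letter dotprod_zero_word tnth_mktuple add0r subr0 mulr1.
Qed.

Lemma tight_swap S w i j : i \in S -> j \in S ->
  tight (inr S) w -> tight (inr S) (swap_letters w i j).
Proof.
move=> iS jS [ww e]; split; first exact: word_swap_letters.
by rewrite dotprod_swap_letters e !mxE iS jS subrr mul0r addr0.
Qed.

Lemma tight_clear S w : tight (inr S) w -> tight (inr S) (clear_outside w S).
Proof.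
move=> /tightrP[ww e]; apply/tightrP; split; first exact: word_clear_outside.
by rewrite -e; apply: eq_bigr => i iS; rewrite tnth_mktuple iS.
Qed.

(** A maximizer of the indicator of [S] is tight. Exactly one position of [S] is above level
    [n - 1]; it carries the letter [n], which a swap inside [S] moves to [i]. *)
Lemma tight_top S i : i \in S -> exists2 w, tight (inr S) w & tnth w i = ord_max.
Proof.
move=> iS; have [w wopt] := @optimal_exists R m n (indicator S).
have wS : tight (inr S) w.
  apply/tightrP; split; first exact: wopt.1.
  apply: optimal_argmax ltr01 _ _ wopt => j jS; rewrite mxE ?jS //.
  by rewrite (negbTE jS) ltr01.
have [ww /(subset_sum_eq _ ww)/(_ n.-1)] := (tightrP S w).1 wS.
rewrite prednK // => /(_ (leqnn _)); rewrite (_ : n - n.-1 = 1)%N; last by lia.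
rewrite (minn_idPr _); last by apply/card_gt0P; exists i.
move=> above1; have /card_gt0P[j] : (0 < #|above w S n.-1|)%N by rewrite above1.
rewrite inE prednK // => /andP[jS wj]; exists (swap_letters w i j).
  exact: tight_swap.
rewrite tnth_mktuple tpermL; apply/val_inj/eqP.
by rewrite eqn_leq wj -ltnS ltn_ord.
Qed.

Lemma tight_exists k : facet_index k -> exists w, tight k w.
Proof.
case: k => [i _|S /andP[/set0Pn[i iS] _]].
  exists zero_word; apply: tightl; first exact: word_zero_word.
  by rewrite tnth_mktuple.
by have [w ?] := tight_top iS; exists w.
Qed.

(** The zero word and the words whose only nonzero letter is a 1 away from [i] are tight, so [a]
    vanishes at all coordinates other than [i]. *)
Lemma tight_constantl i a (d : R) :
  (forall w, tight (inl i) w -> dotprod a (wvec w) = d) ->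
  exists t, a = t *: normal (inl i).
Proof.
move=> ad; exists (- a ord0 i); apply/rowP => j; rewrite !mxE eqxx /= mulrNN.
have [->|ji] := eqVneq j i; first by rewrite mulr1.
have d0 : d = 0.
  rewrite -(ad zero_word) ?dotprod_zero_word //.
  by apply: tightl; [exact: word_zero_word|rewrite tnth_mktuple].
rewrite mulr0 -(dotprod_unit a j) ad //; apply: tightl; first exact: word_unit.
by rewrite !tnth_mktuple eq_sym (negbTE ji).
Qed.

(* Swapping the top letter of a tight word between two positions of S equates
   their coefficients; when |S| < n the letter 1 is not used in S, hence can be
   put anywhere outside of S. *)
Lemma tight_constantr S a (d : R) : facet_subset n S ->
  (forall w, tight (inr S) w -> dotprod a (wvec w) = d) ->
  exists t, a = t *: normal (inr S).
Proof.
move=> /andP[/set0Pn[i iS] Sn] ad; exists (a ord0 i); apply/rowP => j.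
have [w wS wi] := tight_top iS; have [ww wsum] := (tightrP S w).1 wS.
rewrite !mxE; have [jS|jS] := boolP (j \in S).
  rewrite mulr1; have [-> //|ji] := eqVneq j i.
  have := ad _ (tight_swap iS jS wS); rewrite dotprod_swap_letters ad //.
  move=> /eqP; rewrite -subr_eq0 addrAC subrr add0r mulf_eq0 !subr_eq0 eqr_nat.
  (* Equal letters at [i] and [j] are impossible, since the letter at [i] is [n] and thus
     nonzero. *)
  move=> /orP[/eqP //|/eqP/val_inj wji]; case/eqP: ji.
  have wi0 : tnth w i != ord0 by rewrite wi -val_eqE /= -lt0n.
  by apply: (partial_perm_wordP _ ww); rewrite ?inE ?wji.
move: Sn; case/orP => [Sn|/eqP ST]; last by rewrite ST inE in jS.
(* Erasing the letters outside [S] keeps the word tight. As [#|S| <= n - 1], tightness at level 1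
   makes every letter on [S] exceed 1, so the letter 1 is free for [j]. *)
have wS' := tight_clear wS; set w' := clear_outside w S in wS'.
have [ww' /(subset_sum_eq _ ww')/(_ 1%N)] := (tightrP S w').1 wS'.
have S0 : (0 < #|S|)%N by apply/card_gt0P; exists i.
rewrite (minn_idPl _); last by lia.
move=> /(_ _)/eqP; rewrite (leq_ltn_trans S0 Sn) => /(_ isT) aboveS.
have {}aboveS : above w' S 1 = S.
  apply/eqP; rewrite eqEcard (eqP aboveS) leqnn andbT.
  by apply/fintype.subsetP => l; rewrite inE => /andP[].
have w'j : tnth w' j = ord0 by rewrite tnth_mktuple (negbTE jS).
have tj : tight (inr S) (set_letter w' j one_letter).
  split; last by rewrite dotprod_set_letter !mxE (negbTE jS) mul0r addr0 wS'.2.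
  apply: word_set_letter ww' _ => _ l lj; have [lS|lS] := boolP (l \in S).
    by move: lS; rewrite -{1}aboveS inE -val_eqE neq_ltn => /andP[_ ->]; rewrite orbT.
  by rewrite tnth_mktuple (negbTE lS).
have := ad _ tj; rewrite dotprod_set_letter ad // w'j subr0 mulr1 mulr0.
by move=> /eqP; rewrite -subr_eq0 addrAC subrr add0r => /eqP.
Qed.

Lemma tight_constant k a (d : R) : facet_index k ->
  (forall w, tight k w -> dotprod a (wvec w) = d) ->
  exists t, a = t *: normal k.
Proof.
by case: k => [i _|S gS]; [exact: tight_constantl|exact: tight_constantr].
Qed.

Lemma face_words_tight a (b : R) : a != 0 ->
  (forall w, partial_perm_word w -> dotprod a (wvec w) <= b) ->
  exists2 k, facet_index k &
    forall w, partial_perm_word w -> dotprod a (wvec w) = b -> tight k w.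
Proof.
move=> a0 ab.
have opt w : partial_perm_word w -> dotprod a (wvec w) = b -> optimal a w.
  by move=> ww wb; split=> // w' /ab; rewrite wb.
have [/existsP[i ai]|/existsPn apos] := boolP [exists i, a ord0 i < 0].
  exists (inl i) => // w ww /opt-/(_ ww) wopt.
  by apply: tightl ww _; apply: optimal_negative wopt ai.
have [i ai] : exists i, 0 < a ord0 i.
  apply: contrapT => noi; case/eqP: a0; apply/rowP => i; rewrite mxE.
  apply/eqP; rewrite eq_le [0 <= _]leNgt apos andbT leNgt.
  by apply/negP => ai; apply: noi; exists i.
have [S gS Sopt] := optimal_subset_sum (n := n) ai.
exists (inr S) => // w ww /opt-/(_ ww) wopt.
by apply/tightrP; split=> //; exact: Sopt.
Qed.

(** * From words to faces of the polytope *)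

Lemma polytope_word w : partial_perm_word w -> P (wvec w).
Proof. by move=> ww; apply: sub_convex_hull; exists w. Qed.

Lemma polytope_halfspace a (b : R) :
  (forall w, partial_perm_word w -> dotprod a (wvec w) <= b) ->
  forall x, P x -> dotprod a x <= b.
Proof. by move=> ab; apply: convex_hull_halfspace => _ [w ww <-]; exact: ab. Qed.

(* As there are finitely many words, the slack [d - c x] is bounded by a
   multiple of the slack [b - a x] on words, hence on the whole polytope. *)
Lemma polytope_face_sub a c (b d : R) :
  (forall w, partial_perm_word w -> dotprod a (wvec w) <= b) ->
  (forall w, partial_perm_word w -> dotprod c (wvec w) <= d) ->
  (forall w, partial_perm_word w ->
    dotprod a (wvec w) = b -> dotprod c (wvec w) = d) ->
  forall x, P x -> dotprod a x = b -> dotprod c x = d.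
Proof.
move=> ab cd acd x Px ax; apply/eqP; rewrite eq_le (polytope_halfspace cd Px) /=.
(* Where the slack of [a] vanishes, [q] is 0 by the convention for division by 0; the slack of [c]
   vanishes there too. *)
pose q w := (d - dotprod c (wvec w)) / (b - dotprod a (wvec w)).
have q0 w : partial_perm_word w -> 0 <= q w.
  by move=> ww; rewrite divr_ge0 // subr_ge0 ?ab ?cd.
pose M := \sum_(w | partial_perm_word w) q w.
have Mw w : partial_perm_word w ->
    dotprod (M *: a - c) (wvec w) <= M * b - d.
  move=> ww; have qM : q w <= M.
    by rewrite /M (bigD1 w) //= lerDl sumr_ge0 // => w' /andP[ww' _]; exact: q0.
  suff : d - dotprod c (wvec w) <= M * (b - dotprod a (wvec w)).
    rewrite dotprodDl dotprodZl dotprodNl.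
    by rewrite mulrBr; lra.
  have [wb|wb] := eqVneq (dotprod a (wvec w)) b.
    by rewrite (acd _ ww wb) wb !subrr mulr0.
  have slack : 0 < b - dotprod a (wvec w) by rewrite subr_gt0 lt_neqAle wb ab.
  by rewrite -ler_pdivrMr.
(* As [a x = b], this inequality reduces to the missing bound [c x >= d]. *)
have := polytope_halfspace Mw Px.
rewrite dotprodDl dotprodZl dotprodNl ax; lra.
Qed.

(** The origin and the standard basis vectors are words, so only the zero functional is constant on
    the polytope. *)
Lemma has_dim_polytope : has_dim P m.
Proof.
have P0 := polytope_word word_zero_word.
have [U [UP]] := has_dim_normals P0; suff -> : U = 0%VS by rewrite dimv0 subr0.
apply/eqP; rewrite -subv0; apply/subvP => a /UP aP; rewrite memv0.
apply/eqP/rowP => i; rewrite mxE -(dotprod_unit a i) aP ?dotprod_zero_word //.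
exact: polytope_word (word_unit i).
Qed.

Local Open Scope classical_set_scope.
Local Open Scope card_scope.

Definition facet k : set 'rV[R]_m := [set x | P x /\ dotprod (normal k) x = bound k].

Lemma facet_word k w : tight k w -> facet k (wvec w).
Proof. by move=> [ww ?]; split=> //; exact: polytope_word. Qed.

Lemma facets_facet k : facet_index k -> facets P (facet k).
Proof.
move=> gk; split.
  by exists (normal k), (bound k); split=> //; apply: polytope_halfspace; exact: normal_le.
exists m%:Z; split; first exact: has_dim_polytope.
have [w wk] := tight_exists gk; have Fw := facet_word wk.
apply/(has_dim_hyperplane Fw (normal_neq0 gk)) => [y [_ ->]|c cw]; first by rewrite wk.2.
by apply: (tight_constant gk (d := dotprod c (wvec w))) => w' /facet_word/cw.
Qed.

(** Some listed normal is constant on [F]; since [F] has dimension [m - 1], that normal is a nonzero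
    multiple of [a], and both equations cut out the same face. *)
Lemma facets_sub F : facets P F -> exists2 k, facet_index k & F = facet k.
Proof.
move=> [[a [b [ab FE]]] [d [dP dF]]].
have {d dP} dF : has_dim F (m%:Z - 1) by rewrite (has_dim_uniq has_dim_polytope dP).
(* An empty face has dimension -1, whereas [m - 1] is nonnegative. *)
have [y Fy] : exists y, F y.
  apply: contrapT => noy; have F0 : has_dim F (-1).
    by left; split=> //; apply/seteqP; split=> // y Fy; apply: noy; exists y.
  by have := has_dim_uniq F0 dF; lia.
have [Py ay] : P y /\ dotprod a y = b by move: Fy; rewrite FE.
have a0 : a != 0.
  apply/eqP => a0; suff FP : F = P.
    by have := has_dim_uniq has_dim_polytope; rewrite -FP => /(_ _ dF); lia.
  rewrite FE -ay a0; apply/seteqP; split=> [z []|z Pz] //.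
  by split=> //; rewrite !dotprod0l.
have aw w : partial_perm_word w -> dotprod a (wvec w) <= b.
  by move=> /polytope_word; exact: ab.
have [k gk ak] := face_words_tight a0 aw.
have Fk z : F z -> dotprod (normal k) z = bound k.
  rewrite FE => -[Pz az]; apply: (polytope_face_sub aw) Pz az.
    exact: normal_le.
  by move=> w ww wb; case: (ak w ww wb).
have [t kt] : exists t, normal k = t *: a.
  apply: (has_dim_hyperplane Fy a0 _).1 dF _ _ => [z|z /Fk -> //]; last by rewrite Fk.
  by rewrite FE ay => -[].
have t0 : t != 0.
  by apply: contraNneq (normal_neq0 gk) => t0; rewrite kt t0 scale0r.
exists k => //; apply/seteqP; split=> z.
  by move=> Fz; split; [move: Fz; rewrite FE => -[]|exact: Fk].
move=> [Pz kz]; rewrite FE; split=> //; apply: (mulfI t0).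
by rewrite -dotprodZl -kt kz -ay -dotprodZl -kt Fk.
Qed.

Lemma facet_normal k l : facet_index k -> facet k = facet l ->
  exists t, normal l = t *: normal k.
Proof.
move=> gk kl; apply: (tight_constant gk (d := bound l)) => w /facet_word.
by rewrite kl => -[].
Qed.

(** The zero word lies on every [inl] face and on no admissible [inr] face. Within each kind, equal
    faces have proportional normals, which then have the same support. *)
Lemma facet_inj : {in facet_index &, injective facet}.
Proof.
have neq i S : facet_subset n S -> facet (inl i) <> facet (inr S).
  move=> /andP[S0 _] e; have : facet (inl i) (wvec zero_word).
    apply/facet_word/tightl; first exact: word_zero_word.
    by rewrite tnth_mktuple.
  rewrite e => -[_ /eqP]; rewrite dotprod_zero_word eq_sym pnatr_eq0.
  by rewrite -leqn0 leqNgt max_sum_gt0 // card_gt0.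
have sub S T : facet_subset n S -> facet (inr S) = facet (inr T) -> T \subset S.
  move=> gS /(facet_normal (k := inr S) gS)[t /rowP e].
  apply/fintype.subsetP => i iT; apply: contraT => /negbTE iS.
  by have /eqP := e i; rewrite !mxE iT iS mulr0 oner_eq0.
move=> [i|S] [j|T] gk gl e.
- have [t /rowP/(_ j)/eqP] := facet_normal gk e.
  rewrite !mxE !eqxx /=; have [-> //|_] := eqVneq j i.
  by rewrite oppr0 mulr0 oppr_eq0 oner_eq0.
- by case: (neq i T gl).
- by case: (neq j S gk).
- by congr inr; apply/eqP; rewrite finset.eqEsubset (sub T S) ?(sub S T).
Qed.

Lemma card_facets : facets P #= `I_#|facet_index|.
Proof.
pose f (i : 'I_#|facet_index|) := facet (enum_val i).
have finj : injective f.
  by move=> i j /facet_inj e; apply/enum_val_inj/e; exact: enum_valP.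
have -> : facets P = range f.
  apply/seteqP; split=> [F /facets_sub[k gk ->]|_ [i _ <-]].
    by exists (enum_rank_in gk k); rewrite // /f enum_rankK_in.
  exact/facets_facet/enum_valP.
apply: card_eq_trans (card_esym card_II).
by apply: inj_card_eq => i j _ _; exact: finj.
Qed.

End Facets.

(** * Counting the facet indices *)

Lemma card_sets_between (T : finType) (p q : nat) :
  #|[set A : {set T} | (p <= #|A| < q)%N]| = (\sum_(p <= k < q) 'C(#|T|, k))%N.
Proof.
under eq_bigr do rewrite -card_draws -sum1_card big_mkcond /=.
rewrite exchange_big -sum1_card big_mkcond; apply: eq_bigr => A _ /=.
rewrite inE; under eq_bigr do rewrite inE.
(* For a fixed [A], the sum over k has a single term, k = [#|A|], provided that it lies in the
   range. *)
rewrite -big_mkcond /=; under eq_bigl do rewrite eq_sym.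
by rewrite big_nat1_eq; case: ifP.
Qed.

Lemma card_facet_index (m n : nat) : (0 < n)%N ->
  #|@facet_index m n| =
    (m + 2 ^ m - 1 - \sum_(1 <= r < (m - n).+1) 'C(m, m - r))%N.
Proof.
move=> n0; have -> : #|@facet_index m n| = (m + #|@facet_subset m n|)%N.
  by rewrite -!sum1_card big_sumType /= sum1_card card_ord.
(* This is the substitution k = m - r, which reverses the order of summation; both sums are empty if
   [m <= n]. *)
have -> : (\sum_(1 <= r < (m - n).+1) 'C(m, m - r) = \sum_(n <= k < m) 'C(m, k))%N.
  rewrite big_add1 [RHS]big_nat_rev -{2}(add0n n) big_addn /=.
  by apply: eq_bigr => r _; congr 'C(m, _); lia.
have := card_sets_between 'I_m n m; rewrite card_ord => <-.
set B := finset _.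
have e : [set A | facet_subset n A] = ~: (finset.set0 |: B).
  apply/setP => A; rewrite !inE negb_or /facet_subset; congr (_ && _).
  rewrite finset.eqEcard finset.subsetT cardsT card_ord /=.
  by rewrite negb_and -!leqNgt -ltnNge.
(* Positivity of [n] keeps the empty set out of [B], so it accounts for a separate 1 in the
   subtraction from [2 ^ m]. *)
have B0 : finset.set0 \notin B by rewrite inE cards0 leqNgt n0.
have := cardsC (finset.set0 |: B); rewrite -e cardsU1 B0 -cardsT -powersetT.
rewrite card_powerset cardsT card_ord (cardsE (facet_subset n)) => <-.
by rewrite -subnDA addnCA addKn.
Qed.

Local Open Scope classical_set_scope.
Local Open Scope card_scope.

Theorem theorem5p10 (R : realType) (m n : nat) (m_gt0 : (0 < m)%N)
    (n_gt0 : (0 < n)%N) :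
  facets (partial_perm_polytope R m n) #=
    `I_(m + 2 ^ m - 1 - \sum_(1 <= r < (m - n).+1) 'C(m, m - r))%N.
Proof. by rewrite -card_facet_index //; exact: card_facets. Qed.
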